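(* Let $p\in[2,\infty)$ with $p\ne3$. For every simple and regular curve $\gamma\in X_p$ one has $\mathscr{M}_p(\gamma)>0$. Consequently, $\mathscr{M}_p$ has no stationary points: there is no simple and regular $\gamma\in X_p$ such that $\delta\mathscr{M}_p(\gamma,\Phi)=0$ for all $\Phi\in X_p$.
   Context: Functions on $\mathbb{R}/2\pi\mathbb{Z}$ are $2\pi$-periodic functions on $\mathbb{R}$. For $p>3$, $X_p:=W^{2-\frac2p,p}(\mathbb{R}/2\pi\mathbb{Z},\mathbb{R}^3)$, the space of all $\gamma\in W^{1,p}(\mathbb{R}/2\pi\mathbb{Z},\mathbb{R}^3)$ with $\int_0^{2\pi}\int_{-\pi}^{\pi}\frac{|\gamma'(x+w)-\gamma'(x)|^p}{|w|^{p-1}}\,dw\,dx<\infty$ (its elements are $C^1$); for $p\in[2,3)$, $X_p:=C^{1,\alpha}(\mathbb{R}/2\pi\mathbb{Z},\mathbb{R}^3)$ with any fixed $\alpha\in(1-\frac2p,1]$. A closed curve $\gamma$ is simple if $\gamma(s)\ne\gamma(t)$ whenever $s-t\notin2\pi\mathbb{Z}$; a $C^1$ curve is regular if $\gamma'$ never vanishes. For a simple, regular closed curve put $$c_\gamma(s,t,\sigma):=\frac{2\,|(\gamma(t)-\gamma(s))\wedge(\gamma(\sigma)-\gamma(s))|}{|\gamma(t)-\gamma(s)|\,|\gamma(s)-\gamma(\sigma)|\,|\gamma(\sigma)-\gamma(t)|}$$ (with $\wedge$ the cross product; defined off the null set where two arguments differ by an element of $2\pi\mathbb{Z}$) and $$\mathscr{M}_p(\gamma):=\int_0^{2\pi}\int_0^{2\pi}\int_0^{2\pi}c_\gamma(s,t,\sigma)^p\,|\gamma'(s)|\,|\gamma'(t)|\,|\gamma'(\sigma)|\,d\sigma\,dt\,ds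 .$$ The first variation is $\delta\mathscr{M}_p(\gamma,\Phi):=\frac{d}{d\tau}\big|_{\tau=0}\mathscr{M}_p(\gamma+\tau\Phi)$; it exists for all simple regular $\gamma\in X_p$ and all $\Phi\in X_p$. *)

(* Defs.v *)
From HB Require Import structures.
From mathcomp Require Import all_boot all_order all_algebra.
From mathcomp Require Import all_classical all_reals all_analysis.

Set Implicit Arguments.
Unset Strict Implicit.
Unset Printing Implicit Defensive.

Import Order.TTheory GRing.Theory Num.Theory.
Import numFieldNormedType.Exports.

Local Open Scope classical_set_scope.
Local Open Scope ring_scope.

Section Vectors.
Variable R : realType.
Implicit Types u v : 'rV[R]_3.

(* The library norm on matrices is the sup norm, hence this definition. *)
Definition enorm v : R := Num.sqrt (\sum_(i < 3) v 0 i ^+ 2).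

(* Indices are taken modulo 3. *)
Definition cross u v : 'rV[R]_3 :=
  \row_(i < 3) (u 0 (i + 1) * v 0 (i + 2) - u 0 (i + 2) * v 0 (i + 1)).

End Vectors.

Definition period (R : realType) : set R := `[0, 2 * pi].
Arguments period : clear implicits.

(* Functions on R/2piZ are 2pi-periodic functions on R. *)
Section Spaces.
Variable R : realType.
Implicit Types (f g : R -> 'rV[R]_3) (p alpha : R).

Local Notation mu := (@lebesgue_measure R).

Definition C1 f : Prop :=
  (forall x, derivable f x 1) /\ continuous (derive1 f).

Definition C1_holder alpha f : Prop :=
  [/\ periodic f (2 * pi), C1 f &
      exists C : R, forall x y,
        enorm (derive1 f x - derive1 f y) <= C * `|x - y| `^ alpha].

Definition Lp_circle p f : Prop :=
  [/\ periodic f (2 * pi),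
      forall i : 'I_3, measurable_fun setT (fun x => f x 0 i) &
      (\int[mu]_(x in period R) (enorm (f x) `^ p)%:E < +oo)%E].

Definition smooth_periodic (phi : R -> R) : Prop :=
  periodic phi (2 * pi) /\ forall n x, derivable (derive1n n phi) x 1.

Definition weak_derivative f g : Prop :=
  forall (phi : R -> R) (i : 'I_3), smooth_periodic phi ->
    (\int[mu]_(x in period R) (f x 0 i * derive1 phi x)%:E =
     - \int[mu]_(x in period R) (g x 0 i * phi x)%:E)%E.

(* The space W^{2-2/p,p}(R/2piZ,R^3), each class being represented by its
   continuous representative. The first three conjuncts under the
   existential say that f is in W^{1,p} with weak derivative g. *)
Definition sobolev_slobodeckij p f : Prop :=
  continuous f /\
  exists g : R -> 'rV[R]_3,
    [/\ Lp_circle p f, Lp_circle p g, weak_derivative f g &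
        (\int[mu]_(x in period R)
           \int[mu]_(w in `[(- pi)%R, pi%R])
             (enorm (g (x + w) - g x) `^ p / `|w| `^ (p - 1))%:E < +oo)%E].

(* The parameter alpha is only used when p < 3. *)
Definition curve_space p alpha f : Prop :=
  if p < 3 then C1_holder alpha f else sobolev_slobodeckij p f.

Definition simple_closed f : Prop :=
  forall s t, (forall k : int, s - t <> 2 * pi * k%:~R) -> f s <> f t.

Definition regular f : Prop := C1 f /\ forall x, derive1 f x <> 0.

End Spaces.

Section Energy.
Variable R : realType.
Implicit Types (f Phi : R -> 'rV[R]_3) (p : R).

Local Notation mu := (@lebesgue_measure R).

(* The junk value 0 where two of the points coincide only concerns a null set
   when f is simple. *)
Definition menger_curvature f (s t r : R) : R :=
  2 * enorm (cross (f t - f s) (f r - f s)) /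
  (enorm (f t - f s) * enorm (f s - f r) * enorm (f r - f t)).

Definition menger_energy p f : \bar R :=
  (\int[mu]_(s in period R)
     \int[mu]_(t in period R)
       \int[mu]_(r in period R)
         (menger_curvature f s t r `^ p
          * enorm (derive1 f s) * enorm (derive1 f t)
          * enorm (derive1 f r))%:E)%E.

(* The derivative at tau = 0 of the energy of f + tau Phi exists as a real
   number, which requires the energy to be finite near 0, and equals d. *)
Definition is_first_variation p f Phi (d : R) : Prop :=
  let E (tau : R) := menger_energy p (fun x => f x + tau *: Phi x) in
  (\forall tau \near (0 : R), E tau \is a fin_num) /\
  is_derive (0 : R) (1 : R) (fun tau => fine (E tau)) d.

End Energy.

(* Main.v *)
Require Import Defs.
From HB Require Import structures.
From mathcomp Require Import all_boot all_order all_algebra.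
From mathcomp Require Import all_classical all_reals all_analysis.
From mathcomp Require Import ring lra.
Import Order.TTheory GRing.Theory Num.Theory.
Import numFieldNormedType.Exports.
Local Open Scope classical_set_scope.
Local Open Scope ring_scope.

(** A simple closed curve is not contained in a line: on a line, the
intermediate value theorem makes it pass twice through some point. So three of
its points are not collinear, and by continuity the Menger integrand is bounded
below by a positive constant on a box of parameters; hence the energy is
positive. The energy scales as [M_p(k f) = k^(3-p) M_p(f)], so its first
variation at [f] in the direction [f] is [(3 - p) M_p(f)], which does not
vanish when [p <> 3].

The iterated integrals are handled through the definition of the integral of a
nonnegative function as a supremum over simple functions, which needs no
measurability of the partial integrals. *)

(** * Integrals of nonnegative functions as suprema over simple functions *)

Section NonnegIntegral.
Context (d : measure_display) (T : measurableType d) (R : realType).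
Variables (mu : {measure set T -> \bar R}) (D : set T) (f : T -> \bar R).
Hypothesis f_ge0 : forall x, D x -> (0 <= f x)%E.

Import HBNNSimple.

(** Multiplying by [k] turns a simple function below [f] into one below [k f], so the supremum for
    [k f] dominates [k] times the one for [f]. *)
Local Lemma ge0_integralZ_le (k : R) : 0 < k ->
  (k%:E * \int[mu]_(x in D) f x <= \int[mu]_(x in D) (k%:E * f x))%E.
Proof.
move=> k0; rewrite muleC -lee_pdivlMr// ge0_integralE//.
apply: ge_ereal_sup => _ [h hf <-]; rewrite lee_pdivlMr// muleC.
rewrite [leRHS]ge0_integralE; last first.
  by move=> x Dx; rewrite mule_ge0 ?lee_fin ?(ltW k0) ?f_ge0.
apply: ereal_sup_ubound; exists (scale_nnsfun h (ltW k0)); last first.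
  by rewrite -sintegralrM; apply: eq_sintegral.
move=> x /=; rewrite EFinM; have := hf x; rewrite /patch.
case: ifP => _ hx; first by rewrite lee_pmul2l.
by rewrite pmule_rle0.
Qed.

End NonnegIntegral.

(** The missing inequality is the previous lemma applied to [k f] with the factor [k^-1]. *)
Lemma ge0_integralZ_pos (d : measure_display) (T : measurableType d)
    (R : realType) (mu : {measure set T -> \bar R}) (D : set T)
    (f : T -> \bar R) (k : R) :
  (forall x, D x -> (0 <= f x)%E) -> 0 < k ->
  (\int[mu]_(x in D) (k%:E * f x) = k%:E * \int[mu]_(x in D) f x)%E.
Proof.
move=> f0 k0; apply/eqP; rewrite eq_le ge0_integralZ_le// andbT.
rewrite muleC -lee_pdivrMr// muleC.
have kf0 x : D x -> (0 <= k%:E * f x)%E.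
  by move=> Dx; rewrite mule_ge0 ?lee_fin ?(ltW k0) ?f0.
have ki0 : 0 < k^-1 by rewrite invr_gt0.
apply: (le_trans (ge0_integralZ_le _ _ _ mu D _ kf0 _ ki0)).
rewrite le_eqVlt; apply/orP; left; apply/eqP; apply: eq_integral => x _.
by rewrite muleA -EFinM mulVf ?gt_eqF// mul1e.
Qed.

(** The simple function equal to [c] on [A] and 0 elsewhere competes in the supremum that defines
    the integral. *)
Lemma ge0_integral_ge (d : measure_display) (T : measurableType d)
    (R : realType) (mu : {measure set T -> \bar R}) (D A : set T)
    (f : T -> \bar R) (c : R) :
  (forall x, D x -> (0 <= f x)%E) -> measurable A -> A `<=` D -> 0 <= c ->
  (forall x, A x -> (c%:E <= f x)%E) ->
  (c%:E * mu A <= \int[mu]_(x in D) f x)%E.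
Proof.
move=> f0 mA AD c0 cf; rewrite [leRHS]ge0_integralE//.
apply: ereal_sup_ubound.
exists (scale_nnsfun (indic_nnsfun R mA) c0); last first.
  rewrite -(sintegral_indic mu A) -(sintegralrM mu c (indic_nnsfun R mA)).
  by apply: eq_sintegral => x.
move=> x /=; rewrite measurable_realfun.mindicE /patch.
case: (boolP (x \in A)) => xA; last first.
  by rewrite mulr0; case: ifPn => // xD; apply: f0; rewrite inE in xD.
rewrite mulr1 ifT; first by apply: cf; rewrite inE in xA.
by rewrite inE; apply: AD; rewrite inE in xA.
Qed.

Lemma ge0_integralZ_eq (d : measure_display) (T : measurableType d)
    (R : realType) (mu : {measure set T -> \bar R}) (D : set T)
    (f g : T -> \bar R) (k : R) :
  (forall x, (0 <= f x)%E) -> 0 < k -> (forall x, g x = k%:E * f x)%E ->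
  (\int[mu]_(x in D) g x = k%:E * \int[mu]_(x in D) f x)%E.
Proof.
move=> f0 k0 gf; rewrite -ge0_integralZ_pos//.
by apply: eq_integral => x _; exact: gf.
Qed.

(** * Euclidean norm and cross product in three dimensions *)

Section VectorLemmas.
Variable R : realType.
Implicit Types u v : 'rV[R]_3.

Lemma enorm_ge0 v : 0 <= enorm v.
Proof. exact: sqrtr_ge0. Qed.

Lemma enorm_gt0 v : v != 0 -> 0 < enorm v.
Proof.
move=> v0; rewrite sqrtr_gt0 lt_def sumr_ge0 ?andbT; last first.
  by move=> i _; exact: sqr_ge0.
apply: contra v0; rewrite psumr_eq0 => [/allP v0|i _]; last exact: sqr_ge0.
apply/eqP/rowP => i; rewrite mxE; apply/eqP.
by have := v0 i (mem_index_enum _); rewrite sqrf_eq0.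
Qed.

Lemma enormZ (k : R) v : enorm (k *: v) = `|k| * enorm v.
Proof.
rewrite /enorm -sqrtr_sqr -sqrtrM ?sqr_ge0// mulr_sumr; congr Num.sqrt.
by apply: eq_bigr => i _; rewrite mxE exprMn.
Qed.

Lemma crossZ (k : R) u v : cross (k *: u) (k *: v) = k ^+ 2 *: cross u v.
Proof. by apply/rowP => i; rewrite !mxE; ring. Qed.

Lemma sum_ord3 (F : 'I_3 -> R) : \sum_(i < 3) F i = F 0 + F 1 + F 2.
Proof.
rewrite !big_ord_recr big_ord0 /= add0r.
by congr (F _ + F _ + F _); apply: val_inj.
Qed.

Definition dot u v : R := \sum_(i < 3) u 0 i * v 0 i.

(** The difference of the two sides is the triple product of [cross u v] with [u]; each coordinate
    is expanded below. For nonzero [u] this puts [v] on the line spanned by [u]. *)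
Lemma cross_eq0 u v : cross u v = 0 -> dot u u *: v = dot v u *: u.
Proof.
move=> /rowP uv; have := uv 0; have := uv 1; have := uv 2.
have e21 : 2 + 1 = 0 :> 'I_3 by apply: val_inj.
have e22 : 2 + 2 = 1 :> 'I_3 by apply: val_inj.
have e12 : 1 + 2 = 0 :> 'I_3 by apply: val_inj.
rewrite !mxE !add0r e21 e22 e12 (_ : 1 + 1 = 2 :> 'I_3)// => h2 h1 h0.
apply/rowP => i; rewrite !mxE /dot !sum_ord3.
have : [\/ i = 0, i = 1 | i = 2].
  by case: i => [[|[|[|//]]]] ?; [apply: Or31|apply: Or32|apply: Or33];
    apply: val_inj.
case=> ->; apply: subr0_eq.
- transitivity (u 0 2 * (u 0 2 * v 0 0 - u 0 0 * v 0 2)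
    - u 0 1 * (u 0 0 * v 0 1 - u 0 1 * v 0 0)); first by ring.
  by rewrite h1 h2 !mulr0 subr0.
- transitivity (u 0 0 * (u 0 0 * v 0 1 - u 0 1 * v 0 0)
    - u 0 2 * (u 0 1 * v 0 2 - u 0 2 * v 0 1)); first by ring.
  by rewrite h0 h2 !mulr0 subr0.
- transitivity (u 0 1 * (u 0 1 * v 0 2 - u 0 2 * v 0 1)
    - u 0 0 * (u 0 2 * v 0 0 - u 0 0 * v 0 2)); first by ring.
  by rewrite h0 h1 !mulr0 subr0.
Qed.

End VectorLemmas.

Lemma cvg_enorm (R : realType) (T : Type) (F : set_system T) (FF : Filter F)
    (f : T -> 'rV[R]_3) (v : 'rV[R]_3) :
  (forall i, f x 0 i @[x --> F] --> v 0 i) ->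
  enorm (f x) @[x --> F] --> enorm v.
Proof.
move=> fv; rewrite /enorm.
apply: (@continuous_cvg _ _ _ F FF (fun x => \sum_(i < 3) f x 0 i ^+ 2) Num.sqrt).
  exact: sqrt_continuous.
under eq_fun do rewrite sum_ord3.
by rewrite sum_ord3; apply: cvgD; [apply: cvgD|]; apply: cvgM; exact: fv.
Qed.

(** * Non-collinearity and positivity of the energy *)

Section Positivity.
Variables (R : realType) (p : R) (f : R -> 'rV[R]_3).

Lemma ltr_norm_period (s t : R) (k : int) :
  `|s - t| < 2 * pi -> s - t = 2 * pi * k%:~R -> s = t.
Proof.
move=> st e; suff k0 : k = 0 by apply: subr0_eq; rewrite e k0 mulr0.
have pi2 : 0 < 2 * pi :> R by rewrite mulr_gt0// pi_gt0.
move: st; rewrite e normrM gtr0_norm// gtr_pMr//.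
rewrite -intr_norm -[1]/(1%:~R) ltr_int => k1.
by apply/eqP; rewrite -normr_le0 -ltzD1.
Qed.

(** Otherwise the curve lies on the line through [f 0] and [f pi]. The coordinate along this line
    would be injective on one period, yet it goes from 0 up to its value at [pi] and back to 0. *)
Lemma simple_closed_not_collinear :
  periodic f (2 * pi) -> continuous f -> simple_closed f ->
  exists r, 0 <= r < 2 * pi /\ cross (f pi - f 0) (f r - f 0) <> 0.
Proof.
move=> fper fc fs; apply: contrapT => /forallNP H.
have pi0 : 0 < pi :> R := pi_gt0 R.
have cr r : 0 <= r < 2 * pi -> cross (f pi - f 0) (f r - f 0) = 0.
  by move=> hr; apply: contrapT => h; apply: (H r).
have finj s t : 0 <= s < 2 * pi -> 0 <= t < 2 * pi -> f s = f t -> s = t.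
  move=> hs ht est; apply: contrapT => st.
  apply: (fs s t) => // k hk; apply: st.
  by apply: ltr_norm_period hk; rewrite ltr_norml; lra.
set u := f pi - f 0.
have u0 : u != 0.
  rewrite subr_eq0; apply/eqP => /finj e.
  have : pi = 0 :> R by apply: e; lra.
  by move=> e0; rewrite e0 ltxx in pi0.
have uu : 0 < dot R u u.
  have := enorm_gt0 R u u0; rewrite sqrtr_gt0 /dot.
  by under eq_bigr do rewrite expr2.
(* The unnormalized coordinate along [u]; it equals [dot u u] at [pi]. *)
pose phi r := dot R (f r - f 0) u.
have phic : continuous phi.
  move=> x; rewrite /phi /dot /continuous_at.
  under eq_fun do rewrite sum_ord3.
  have fi i : (f x - f 0) 0 i @[x --> x] --> (f x - f 0) 0 i.
    under eq_fun do rewrite !mxE.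
    rewrite !mxE; apply: cvgB; last exact: cvg_cst.
    apply: (@continuous_cvg _ _ _ _ _ f (fun M : 'rV[R]_3 => M 0 i)).
      exact: coord_continuous.
    exact: fc.
  by rewrite sum_ord3; apply: cvgD; [apply: cvgD|];
    apply: cvgMl; exact: fi.
have phi_inj s t : 0 <= s < 2 * pi -> 0 <= t < 2 * pi ->
    phi s = phi t -> s = t.
  move=> hs ht est; apply: finj => //; apply: (@addIr _ (- f 0)).
  (* Collinearity gives [dot u u *: (f s - f 0) = phi s *: u], so [phi s] determines [f s]. *)
  apply: (scalerI (lt0r_neq0 uu)).
  by rewrite (cross_eq0 R u _ (cr s hs))
    (cross_eq0 R u _ (cr t ht)) -/(phi s) est.
have phi0 : phi 0 = 0.
  by rewrite /phi subrr /dot big1// => i _; rewrite mxE mul0r.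
have phi2pi : phi (2 * pi) = 0.
  by rewrite -phi0 /phi -[2 * pi]add0r fper.
have phipi : phi pi = dot R u u by [].
(* Half of [dot u u] lies strictly between the end values of [phi] on each half period, so it is
   attained on both. *)
have ivt a b : a <= b -> Num.min (phi a) (phi b) = 0 ->
    Num.max (phi a) (phi b) = dot R u u ->
    exists2 c, c \in `[a, b] & phi c = dot R u u / 2.
  move=> ab mn mx; apply: IVT => //; last by rewrite mn mx; lra.
  exact: continuous_subspaceT.
have [c c0pi phc] : exists2 c, c \in `[0, pi] & phi c = dot R u u / 2.
  apply: ivt; first exact: ltW.
    by rewrite phi0 phipi min_l// ltW.
  by rewrite phi0 phipi max_r// ltW.
have [e epi phe] : exists2 c, c \in `[pi, 2 * pi] & phi c = dot R u u / 2.
  apply: ivt; first lra.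
    by rewrite phi2pi phipi min_r// ltW.
  by rewrite phi2pi phipi max_l// ltW.
rewrite !in_itv /= in c0pi epi.
(* Injectivity holds on the half-open period only, so the right end has to be excluded. *)
have enpi : e != 2 * pi.
  by apply/eqP => e2; move: phe; rewrite e2 phi2pi; lra.
have e2pi : e < 2 * pi by rewrite lt_neqAle enpi; lra.
have ce : c = e by apply: phi_inj; [lra|lra|rewrite phc phe].
(* The halves meet only at [pi], where [phi] has the full value and not half of it. *)
have cpi : c = pi by lra.
by move: phc; rewrite cpi phipi; lra.
Qed.

(** The interval extends to the right of [x] only: [x] may be the left end 0 of the period, and
    there is always room before [2 * pi]. *)
Lemma nbhs_period_itv (x : R) (U : set R) : 0 <= x < 2 * pi -> nbhs x U ->
  exists a b, a < b /\ `[a, b] `<=` U `&` period R.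
Proof.
move=> hx /nbhs_ballP[e /= e0 eU].
exists x, (Num.min (x + e / 2) (2 * pi)); split.
  by rewrite lt_min; lra.
move=> y /=; rewrite in_itv /= le_min => hy; split; last first.
  by rewrite /period /= in_itv /=; lra.
by apply: eU; rewrite /ball /= ltr_norml; lra.
Qed.

Hypotheses (fC1 : C1 f) (fper : periodic f (2 * pi)) (fs : simple_closed f).
Hypothesis freg : forall x, derive1 f x <> 0.

Let F s t r := menger_curvature f s t r `^ p
  * enorm (derive1 f s) * enorm (derive1 f t) * enorm (derive1 f r).

Lemma C1_continuous : continuous f.
Proof.
move=> x; apply: differentiable_continuous; apply/derivable1_diffP.
exact: fC1.1.
Qed.

Lemma menger_integrand_ge0 s t r : 0 <= F s t r.
Proof. by rewrite /F !mulr_ge0 ?powR_ge0 ?enorm_ge0. Qed.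

(** Non-collinear points are pairwise distinct, so the denominator stays away from 0 near them and
    the quotient is continuous there. *)
Lemma cvg_menger_curvature (T : Type) (G : set_system T) (FG : Filter G)
    (s t r : T -> R) (s0 t0 r0 : R) :
  s @ G --> s0 -> t @ G --> t0 -> r @ G --> r0 ->
  cross (f t0 - f s0) (f r0 - f s0) <> 0 ->
  [/\ 0 < menger_curvature f s0 t0 r0 &
      menger_curvature f (s x) (t x) (r x) @[x --> G]
        --> menger_curvature f s0 t0 r0].
Proof.
move=> sG tG rG h.
have fG (y : T -> R) y0 i : y @ G --> y0 -> f (y x) 0 i @[x --> G] --> f y0 0 i.
  move=> yG; apply: (@continuous_cvg _ _ _ _ _ _ (fun M : 'rV[R]_3 => M 0 i)).
    exact: coord_continuous.
  by apply: (@continuous_cvg _ _ _ _ _ _ f) => //; exact: C1_continuous.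
have dG (y z : T -> R) y0 z0 i : y @ G --> y0 -> z @ G --> z0 ->
    (f (y x) - f (z x)) 0 i @[x --> G] --> (f y0 - f z0) 0 i.
  move=> yG zG; under eq_fun do rewrite !mxE.
  by rewrite !mxE; apply: cvgB; exact: fG.
(* If two of the three points coincided, the cross product would vanish. *)
have d0 : 0 < enorm (f t0 - f s0) * enorm (f s0 - f r0) * enorm (f r0 - f t0).
  rewrite !mulr_gt0// enorm_gt0//; apply/eqP => e; apply: h.
  - by rewrite e; apply/rowP => i; rewrite !mxE !mul0r subrr.
  - have -> : f r0 - f s0 = 0 by rewrite -opprB e oppr0.
    by apply/rowP => i; rewrite !mxE !mulr0 subrr.
  - by rewrite (subr0_eq e); apply/rowP => i; rewrite !mxE mulrC subrr.
split.
  rewrite /menger_curvature divr_gt0// mulr_gt0// enorm_gt0//.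
  exact/eqP.
apply: cvgM; last first.
  apply: cvgV; first by rewrite gt_eqF.
  by apply: cvgM; [apply: cvgM|]; apply: cvg_enorm => i; apply: dG.
apply: cvgMr; apply: cvg_enorm => i.
under eq_fun do rewrite mxE.
by rewrite mxE; apply: cvgB; apply: cvgM; apply: dG.
Qed.

Lemma cvg_menger_integrand (T : Type) (G : set_system T) (FG : Filter G)
    (s t r : T -> R) (s0 t0 r0 : R) :
  s @ G --> s0 -> t @ G --> t0 -> r @ G --> r0 ->
  cross (f t0 - f s0) (f r0 - f s0) <> 0 ->
  0 < F s0 t0 r0 /\ F (s x) (t x) (r x) @[x --> G] --> F s0 t0 r0.
Proof.
move=> sG tG rG h.
have [c0 cG] := cvg_menger_curvature T G FG s t r s0 t0 r0 sG tG rG h.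
split.
  by rewrite !mulr_gt0 ?powR_gt0// enorm_gt0//; exact/eqP.
have dG (y : T -> R) y0 : y @ G --> y0 ->
    enorm (derive1 f (y x)) @[x --> G] --> enorm (derive1 f y0).
  move=> yG; apply: cvg_enorm => i.
  apply: (@continuous_cvg _ _ _ _ _ _ (fun M : 'rV[R]_3 => M 0 i)).
    exact: coord_continuous.
  by apply: (@continuous_cvg _ _ _ _ _ _ (derive1 f)) => //; exact: fC1.2.
apply: cvgM; [apply: cvgM; [apply: cvgM|]|]; try exact: dG.
(* Continuity of the power is obtained at a positive base, which the curvature supplies. *)
apply: (@continuous_cvg _ _ _ _ _ _ (fun x => x `^ p)) => //.
apply: differentiable_continuous; apply/derivable1_diffP.
by apply: derivable_powR; rewrite in_itv /= c0.
Qed.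

Lemma menger_energy_gt0 : (0 < menger_energy p f)%E.
Proof.
have [r0 [r0P h]] := simple_closed_not_collinear fper C1_continuous fs.
have pi0 : 0 < pi :> R := pi_gt0 R.
pose G := nbhs ((0 : R), (pi : R), r0).
have [F0 FG] : 0 < F 0 pi r0 /\ F x.1.1 x.1.2 x.2 @[x --> G] --> F 0 pi r0.
  apply: cvg_menger_integrand => //.
  - by apply: (@cvg_comp _ _ _ fst fst); exact: cvg_fst.
  - by apply: (@cvg_comp _ _ _ fst snd); [exact: cvg_fst|exact: cvg_snd].
  - exact: cvg_snd.
have Fe : F 0 pi r0 / 2 < F 0 pi r0 by lra.
(* Near the chosen triple the integrand exceeds half of its value there; this half becomes the lower
   bound [e] on a box. *)
have := cvgr_gt _ FG _ Fe.
set e := F 0 pi r0 / 2 in Fe *; have e0 : 0 < e by rewrite /e; lra.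
clearbody e; move=> [[ST W] /= [[[S T] /= [nS nT] STP] nW] STWP].
have [a1 [b1 [ab1 S1]]] := nbhs_period_itv 0 S ltac:(lra) nS.
have [a2 [b2 [ab2 S2]]] := nbhs_period_itv pi T ltac:(lra) nT.
have [a3 [b3 [ab3 S3]]] := nbhs_period_itv r0 W r0P nW.
have FE s t r : s \in `[a1, b1] -> t \in `[a2, b2] -> r \in `[a3, b3] ->
    e <= F s t r.
  move=> /S1[Ss _] /S2[Tt _] /S3[Wr _]; apply: ltW.
  by apply: (STWP (s, t, r)); split => //=; apply: (STP (s, t)).
(* Used once per integral, from the outermost inwards; each use contributes one side length of the
   box. *)
have int_ge (a b c : R) (g : R -> \bar R) : a < b -> `[a, b] `<=` period R ->
    0 <= c -> (forall x, 0 <= g x)%E ->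
    (forall x, x \in `[a, b] -> c%:E <= g x)%E ->
    ((c * (b - a))%:E <= \int[lebesgue_measure]_(x in period R) g x)%E.
  move=> ab abP c0 g0 cg.
  have m : @lebesgue_measure R `[a, b]%classic = (b - a)%:E.
    by rewrite lebesgue_measure_itv /= lte_fin ab.
  rewrite EFinM -m; apply: ge0_integral_ge => //.
apply: (@lt_le_trans _ _ (e * (b3 - a3) * (b2 - a2) * (b1 - a1))%:E).
  by rewrite lte_fin !mulr_gt0 ?subr_gt0.
apply: (int_ge a1 b1).
- exact: ab1.
- by move=> x /S1[].
- by rewrite !mulr_ge0 ?subr_ge0 ?ltW.
- by move=> s; do 2!apply: integral_ge0 => ? _;
    rewrite lee_fin menger_integrand_ge0.
move=> s sP; apply: (int_ge a2 b2).
- exact: ab2.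
- by move=> x /S2[].
- by rewrite !mulr_ge0 ?subr_ge0 ?ltW.
- by move=> t; apply: integral_ge0 => ? _;
    rewrite lee_fin menger_integrand_ge0.
move=> t tP; apply: (int_ge a3 b3).
- exact: ab3.
- by move=> x /S3[].
- exact: ltW.
- by move=> r; rewrite lee_fin menger_integrand_ge0.
by move=> r rP; rewrite lee_fin; exact: FE.
Qed.

End Positivity.

(** * Scaling of the energy and the first variation *)

Lemma menger_curvatureZ (R : realType) (f : R -> 'rV[R]_3) (k s t r : R) :
  0 < k ->
  menger_curvature (fun x => k *: f x) s t r = k^-1 * menger_curvature f s t r.
Proof.
move=> k0; rewrite /menger_curvature -!scalerBr crossZ !enormZ.
rewrite !gtr0_norm ?exprn_gt0//.
set C := enorm (cross _ _).
set a := enorm _; set b := enorm _; set c := enorm _.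
have -> : k * a * (k * b) * (k * c) = k ^+ 3 * (a * b * c) by ring.
(* Generalizing the inverse also covers coinciding points, where it is 0 by convention. *)
by rewrite invfM; move: (a * b * c)^-1 => D; field; rewrite gt_eqF.
Qed.

(** The curvature contributes [k^-1] to the power [p] and the three speeds contribute [k ^+ 3]; the
    constant then leaves the integrals one by one. *)
Lemma menger_energyZ (R : realType) (p : R) (f : R -> 'rV[R]_3) (k : R) :
  (forall x, derivable f x 1) -> 0 < k ->
  menger_energy p (fun x => k *: f x) =
  ((k `^ (3 - p))%:E * menger_energy p f)%E.
Proof.
move=> df k0; set K := k `^ (3 - p).
have K0 : 0 < K by exact: powR_gt0.
have dk x : derive1 (fun x => k *: f x) x = k *: derive1 f x.
  by rewrite !derive1E; exact: deriveZ.
have ek x : enorm (derive1 (fun x => k *: f x) x) = k * enorm (derive1 f x).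
  by rewrite dk enormZ gtr0_norm.
have FK s t r : menger_curvature (fun x => k *: f x) s t r `^ p
    * enorm (derive1 (fun x => k *: f x) s)
    * enorm (derive1 (fun x => k *: f x) t)
    * enorm (derive1 (fun x => k *: f x) r) =
    K * (menger_curvature f s t r `^ p * enorm (derive1 f s)
    * enorm (derive1 f t) * enorm (derive1 f r)).
  rewrite menger_curvatureZ// powRM ?invr_ge0 ?(ltW k0)//; last first.
    by rewrite divr_ge0 ?mulr_ge0 ?enorm_ge0.
  rewrite (ek s) (ek t) (ek r).
  have -> : K = k^-1 `^ p * k ^+ 3.
    rewrite /K powRD ?(gt_eqF k0) ?implybT// (powR_mulrn 3) ?(ltW k0)//.
    by rewrite -powR_inv1 ?(ltW k0)// -powRrM mulN1r mulrC.
  move: (enorm (derive1 f s)) (enorm (derive1 f t)) (enorm (derive1 f r)).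
  move: (k^-1 `^ p) (menger_curvature f s t r `^ p) => x1 x2 x3 x4 x5.
  by ring.
rewrite /menger_energy; apply: ge0_integralZ_eq => // s.
  by do 2!apply: integral_ge0 => ? _;
    rewrite lee_fin !mulr_ge0 ?powR_ge0 ?enorm_ge0.
apply: ge0_integralZ_eq => // t.
  by apply: integral_ge0 => ? _;
    rewrite lee_fin !mulr_ge0 ?powR_ge0 ?enorm_ge0.
apply: ge0_integralZ_eq => // r.
  by rewrite lee_fin !mulr_ge0 ?powR_ge0 ?enorm_ge0.
by rewrite -EFinM; congr (_%:E); exact: FK.
Qed.

(** As [f + tau f = (1 + tau) f], the energy along this path is an explicit power of [1 + tau] times
    a constant, for [tau > -1]. *)
Lemma first_variation_self (R : realType) (p : R) (f : R -> 'rV[R]_3) (d : R) :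
  (forall x, derivable f x 1) -> is_first_variation p f f d ->
  menger_energy p f \is a fin_num /\ d = (3 - p) * fine (menger_energy p f).
Proof.
move=> df [Efin Ed].
have E1 (tau : R) : -1 < tau -> menger_energy p (fun x => f x + tau *: f x) =
    (((1 + tau) `^ (3 - p))%:E * menger_energy p f)%E.
  move=> tau1.
  have -> : (fun x => f x + tau *: f x) = (fun x => (1 + tau) *: f x).
    by apply/funext => x; rewrite scalerDl scale1r.
  by apply: menger_energyZ => //; lra.
(* Finiteness near 0 is read off at [tau = 0] itself. *)
have E0 : menger_energy p f \is a fin_num.
  have := nbhs_singleton Efin; rewrite E1 ?ltrN10//.
  by rewrite addr0 powR1 mul1e.
split=> //; have near_E : \forall tau \near (0 : R),
    fine (menger_energy p (fun x => f x + tau *: f x)) =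
    (1 + tau) `^ (3 - p) * fine (menger_energy p f).
  have : \forall tau \near (0 : R), -1 < tau by apply: lt_nbhsr; rewrite ltrN10.
  apply: filterS => tau tau1; rewrite E1// -[in LHS](fineK E0).
  by rewrite -EFinM.
have := near_eq_is_derive near_E Ed.
pose M := fine (menger_energy p f).
have Ed' : is_derive (0 : R) (1 : R) (fun tau => (1 + tau) `^ (3 - p) * M)
    ((3 - p) * M).
  have D1 : is_derive (0 : R) (1 : R) (fun tau : R => 1 + tau) 1.
    by rewrite -[X in is_derive _ _ _ X]add0r; exact: is_deriveD.
  have D2 : is_derive ((fun tau : R => 1 + tau) 0) 1
      (fun x : R => x `^ (3 - p)) (3 - p).
    rewrite /= addr0 -[X in is_derive _ _ _ X]mulr1.
    have := @is_derive1_powR R (3 - p) 1 ltr01.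
    by rewrite powR1.
  have -> : (fun tau => (1 + tau) `^ (3 - p) * M) =
      M \*: ((fun x : R => x `^ (3 - p)) \o (fun tau => 1 + tau)).
    by apply/funext => tau; rewrite mulrC.
  have -> : (3 - p) * M = M *: ((3 - p) * 1 : R) by rewrite mulr1 mulrC.
  by apply: is_deriveZ; exact: is_derive1_comp.
(* Both [d] and [(3 - p) * M] are derivatives at 0 of the same function, hence equal. *)
move=> H; rewrite -(derive_val (is_derive := H)).
by rewrite -(derive_val (is_derive := Ed')).
Qed.

Lemma curve_space_periodic (R : realType) (p alpha : R) (f : R -> 'rV[R]_3) :
  curve_space p alpha f -> periodic f (2 * pi).
Proof. by rewrite /curve_space; case: ifP => _ [] // _ [g [[]]]. Qed.

Theorem mainTheorem5 (R : realType) (p alpha : R)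
    (p_ge2 : 2 <= p) (p_neq3 : p <> 3)
    (alphaP : p < 3 -> 1 - 2 / p < alpha <= 1) :
  (forall gamma : R -> 'rV[R]_3,
     curve_space p alpha gamma -> simple_closed gamma -> regular gamma ->
     (0 < menger_energy p gamma)%E) /\
  ~ (exists gamma : R -> 'rV[R]_3,
       [/\ curve_space p alpha gamma, simple_closed gamma, regular gamma &
           forall Phi : R -> 'rV[R]_3, curve_space p alpha Phi ->
             is_first_variation p gamma Phi 0]).

Proof.
have pos gamma : curve_space p alpha gamma -> simple_closed gamma ->
    regular gamma -> (0 < menger_energy p gamma)%E.
  move=> /curve_space_periodic gper gs [gC1 greg].
  exact: menger_energy_gt0.
split=> // -[gamma [gX gs greg stat]].
(* The curve itself lies in the space, so it is an admissible direction. *)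
have [Efin E0] := first_variation_self R p gamma 0 greg.1.1 (stat gamma gX).
(* Finiteness turns positivity of the extended real energy into positivity of its real value. *)
have := fine_gt0 (x := menger_energy p gamma).
rewrite pos//= ltey_eq Efin => /(_ isT) M0.
have : 3 - p != 0 by rewrite subr_eq0 eq_sym; exact/eqP.
by move: E0 => /esym/eqP; rewrite mulf_eq0 (gt_eqF M0) orbF => ->.
Qed.
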